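(* Let $G=(V,E,\omega)\in\mathcal{G}$. Let $\{\varepsilon_k\}_{k\in\mathbb{N}}\subset(0,\infty)$ be a sequence such that $\varepsilon_k\downarrow0$ as $k\to\infty$ and, for each $k\in\mathbb{N}$, let $f_{\varepsilon_k}^+:\mathcal{V}\to\mathbb{R}$ be given by $$f_{\varepsilon_k}^+(u):=\frac12\sum_{i,j\in V}\omega_{ij}(u_i+u_j)^2+\frac1{\varepsilon_k}\sum_{i\in V}W(u_i),$$ and let $u_{\varepsilon_k}$ be a minimizer of $f_{\varepsilon_k}^+$ over $\mathcal{V}$. Then there exist $u_0\in\mathcal{V}^b$ and a subsequence $\{u_{\varepsilon_{k'}}\}_{k'\in\mathbb{N}}\subset\{u_{\varepsilon_k}\}_{k\in\mathbb{N}}$ such that $\|u_{\varepsilon_{k'}}-u_0\|_{\mathcal{V}}\to0$ as $k'\to\infty$. Furthermore, $u_0\in\operatorname{argmin}_{u\in\mathcal{V}}f_0^+(u)$, where $$f_0^+(u):=\begin{cases}\sum_{i,j\in V}\omega_{ij}|u_i+u_j|,&\text{if }u\in\mathcal{V}^b,\\ +\infty,&\text{if }u\in\mathcal{V}\setminus\mathcal{V}^b.\end{cases}$$ In particular, if $C_{u_0}\in\mathcal{C}$ is the cut induced by $u_0$, then $C_{u_0}$ is a maximum cut of $G$.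
   Context: $\mathcal{G}$ denotes the set of non-empty finite, simple (no self-loops, no multiple edges), undirected, edge-weighted graphs $G=(V,E,\omega)$ without isolated nodes, with $V=\{1,\dots,n\}$. The edge weights satisfy $\omega_{ij}=\omega_{ji}>0$ if $(i,j)\in E$, and $\omega$ is extended to $V^2$ by $\omega_{ij}=0$ if $(i,j)\notin E$ (in particular $\omega_{ii}=0$). The degree of node $i$ is $d_i:=\sum_{j\in V}\omega_{ij}$, so $d_i>0$. $\mathcal{V}$ is the set of all functions $u:V\to\mathbb{R}$ (write $u_i:=u(i)$), with norm $\|u\|_{\mathcal{V}}:=\left(\sum_{i\in V}u_i^2d_i^r\right)^{1/2}$ for a fixed $r\in[0,1]$. $\mathcal{V}^b:=\{u\in\mathcal{V}:\forall i\in V,\ u_i\in\{-1,1\}\}$. $W(x):=(x^2-1)^2$ for $x\in\mathbb{R}$. For $u\in\mathcal{V}^b$ the cut induced by $u$ is the partition $C_u=V_{-1}|V_1$ with $V_{k}:=\{i\in V:u_i=k\}$ for $k\in\{-1,1\}$ (one of the two sets may be empty); $\mathcal{C}$ is the set of all cuts induced by functions in $\mathcal{V}^b$. The size of a cut $C=V_{-1}|V_1$ is $s(C):=\sum_{i\in V_{-1},\,j\in V_1}\omega_{ij}$. A maximum cut of $G$ is a cut $C^*\in\mathcal{C}$ such that $s(C)\leq s(C^* )$ for all $C\in\mathcal{C}$. *)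

(* Defs.v *)
From HB Require Import structures.
From mathcomp Require Import all_boot all_order all_algebra.
From mathcomp Require Import boolp classical_sets reals ereal topology.
From mathcomp Require Import normedtype sequences exp.
Set Implicit Arguments.
Unset Strict Implicit.
Unset Printing Implicit Defensive.
Import Order.TTheory GRing.Theory Num.Theory.
Import numFieldNormedType.Exports.
Local Open Scope classical_set_scope.
Local Open Scope ring_scope.

(* [weight] is the weight function already extended by 0 to all pairs. *)
Record wgraph (R : realType) := WGraph {
  nnodes : nat;
  nnodes_gt0 : (0 < nnodes)%N;
  edge : rel 'I_nnodes;
  edge_sym : symmetric edge;
  edge_irrefl : irreflexive edge;
  edge_nonisolated : forall i, exists j, edge i j;
  weight : 'I_nnodes -> 'I_nnodes -> R;
  weight_sym : forall i j, weight i j = weight j i;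
  weight_gt0 : forall i j, edge i j -> 0 < weight i j;
  weight_eq0 : forall i j, ~~ edge i j -> weight i j = 0 }.

Section Graph.
Variables (R : realType) (G : wgraph R).

Definition node := 'I_(nnodes G).
Definition nodefun := node -> R.

Definition degree (i : node) : R := \sum_(j : node) weight i j.

Definition normV (r : R) (u : nodefun) : R :=
  Num.sqrt (\sum_(i : node) u i ^+ 2 * degree i `^ r).

Definition Vb : set nodefun := [set u | forall i, u i = -1 \/ u i = 1].

Definition W (x : R) : R := (x ^+ 2 - 1) ^+ 2.

Definition f_eps (eps : R) (u : nodefun) : R :=
  2^-1 * (\sum_(i : node) \sum_(j : node) weight i j * (u i + u j) ^+ 2)
  + eps^-1 * \sum_(i : node) W (u i).

Definition f_zero (u : nodefun) : \bar R :=
  if u \in Vb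
  then (\sum_(i : node) \sum_(j : node) weight i j * `|u i + u j|)%:E
  else +oo%E.

(* The cut V_{-1}|V_1 is the pair (V_{-1}, V_1); either part may be empty. *)
Definition cut := ({set node} * {set node})%type.

Definition induced_cut (u : nodefun) : cut :=
  ([set i : node | u i == -1]%SET, [set i : node | u i == 1]%SET).

Definition cuts : set cut := induced_cut @` Vb.

Definition cut_size (C : cut) : R :=
  \sum_(i in C.1) \sum_(j in C.2) weight i j.

Definition maximum_cut (C : cut) : Prop :=
  cuts C /\ forall C', cuts C' -> cut_size C' <= cut_size C.

End Graph.

Definition argmin (T : Type) (d : Order.disp_t) (S : porderType d)
    (f : T -> S) : set T :=
  [set x | forall y, (f x <= f y)%O].

(* Main.v *)
Require Import Defs.
From mathcomp Require Import all_boot all_order all_algebra.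
From mathcomp Require Import boolp classical_sets reals ereal topology.
From mathcomp Require Import normedtype sequences exp.
From mathcomp Require Import realfun ring lra.
Import Order.TTheory GRing.Theory Num.Theory.
Import numFieldNormedType.Exports.
Local Open Scope classical_set_scope.
Local Open Scope ring_scope.

(** The functionals [f_eps] and [f_zero] are tied together by the signless
    Dirichlet energy [Q u] (below, [energy u]), half the sum of the
    [weight i j * (u i + u j) ^+ 2].  On [Vb] the double well vanishes and
    [(u i + u j) ^+ 2 / 2 = `|u i + u j|], so there [f_eps], for every [eps],
    and [f_zero] all equal [Q] ([f_eps_Vb], [f_zero_Vb]).  Moreover an edge
    contributes to [Q] exactly when it is not cut, so that [Q] is an affine
    decreasing function of the size of the cut ([energy_cut]): minimizing [Q]
    over [Vb] is maximizing the cut.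

    Comparing a minimizer [u k] of [f_eps (eps k)] with any [v] in [Vb] gives
    both [Q (u k) <= Q v] and [W (u k i) <= eps k * Q v] ([argmin_energy_le],
    [argmin_well_le]).  The second bound forces [`|u k i|] to tend to 1, since
    [W] dominates the squared distance to the nearer well ([dist_sign_W]).
    Compactness is then a matter of signs only: there are finitely many sign
    patterns, hence one of them recurs infinitely often
    ([finite_range_subseq]), and along that subsequence [u k] converges to the
    pattern [u0], at rate [Num.sqrt (eps k)].  Passing to the limit in the
    first bound, by continuity of [Q], gives [Q u0 <= Q v] for all [v] in
    [Vb], which is the minimality of [u0] and the maximality of its cut. *)

(** * A recurring value of a sequence in a finite type *)

(** If every value occurred only up to some rank, no value could be taken
    beyond the largest of these finitely many ranks. *)
Lemma finite_range_recurrent (T : finType) (s : nat -> T) :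
  exists t, forall N, exists n, (N <= n)%N /\ s n = t.
Proof.
apply: contrapT => /forallNP noT.
have /choice[N NP] t : exists N, forall n, (N <= n)%N -> s n <> t.
  have /existsNP[N /forallNP NP] := noT t.
  by exists N => n Nn snt; exact: (NP n (conj Nn snt)).
pose M := (\max_t N t)%N.
by apply: (NP (s M) M) => //; apply: (leq_bigmax (F := N)).
Qed.

Lemma finite_range_subseq (T : finType) (s : nat -> T) :
  exists t phi, increasing_seq phi /\ forall k, s (phi k) = t.
Proof.
have [t /choice[g gP]] := finite_range_recurrent T s.
pose phi := fix phi k := if k is k'.+1 then g (phi k').+1 else g 0.
exists t, phi; split.
  by apply/increasing_seqP => k; case: (gP (phi k).+1).
by case=> [|k]; [case: (gP 0)|case: (gP (phi k).+1)].
Qed.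

(** * The signless Dirichlet energy *)

Section Energy.
Variables (R : realType) (G : wgraph R).
Implicit Types u v : nodefun G.

Definition energy u : R :=
  2^-1 * \sum_(i : node G) \sum_(j : node G) weight i j * (u i + u j) ^+ 2.

Lemma weight_ge0 (i j : node G) : 0 <= weight i j.
Proof.
have [/weight_gt0/ltW//|/weight_eq0->//] := boolP (edge i j).
Qed.

Lemma energy_ge0 u : 0 <= energy u.
Proof.
rewrite mulr_ge0 ?invr_ge0 ?ler0n//; apply: sumr_ge0 => i _; apply: sumr_ge0.
by move=> j _; rewrite mulr_ge0 ?weight_ge0 ?sqr_ge0.
Qed.

Lemma W_ge0 (x : R) : 0 <= W x.
Proof. exact: sqr_ge0. Qed.

Lemma f_eps_Vb (eps : R) v : Vb v -> f_eps eps v = energy v.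
Proof.
move=> vb; rewrite /f_eps [X in _ + _ * X]big1 ?mulr0 ?addr0// => i _.
by rewrite /W; case: (vb i) => ->; ring.
Qed.

Lemma f_zero_Vb v : Vb v -> f_zero v = (energy v)%:E.
Proof.
move=> vb; rewrite /f_zero mem_set//; congr (_%:E).
rewrite /energy mulr_sumr; apply: eq_bigr => i _.
rewrite mulr_sumr; apply: eq_bigr => j _.
have -> : `|v i + v j| = 2^-1 * (v i + v j) ^+ 2.
  case: (vb i) (vb j) => -> [] ->; last by rewrite ger0_norm; [field|lra].
  - by rewrite ler0_norm; [field|lra].
  - by rewrite addNr normr0; ring.
  - by rewrite subrr normr0; ring.
by ring.
Qed.

(** On [Vb] the indicators of the two sides are affine in [v], which makes the
    size of the cut a quadratic form. *)
Lemma cut_size_quadratic v : Vb v ->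
  cut_size (induced_cut v) = \sum_(i : node G) \sum_(j : node G)
    weight i j * ((1 - v i) / 2 * ((1 + v j) / 2)).
Proof.
move=> vb; rewrite /cut_size big_mkcond/=; apply: eq_bigr => i _.
have N11 : ((-1 : R) == 1) = false by apply/eqP; lra.
rewrite inE; case: (vb i) => ->; last first.
  rewrite eq_sym N11 big1// => j _; ring.
rewrite eqxx big_mkcond/=; apply: eq_bigr => j _.
by rewrite inE; case: (vb j) => ->; rewrite ?eqxx ?N11; field.
Qed.

(** An uncut ordered pair has [(v i + v j) ^+ 2 / 2 = 2] and a cut one 0, while
    each cut pair is counted in both orders. *)
Lemma energy_cut v : Vb v ->
  energy v = 2 * (\sum_(i : node G) \sum_(j : node G) weight i j)
             - 4 * cut_size (induced_cut v).
Proof.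
move=> vb; have cutE := cut_size_quadratic v vb.
(* The size of the cut does not depend on which side is listed first. *)
have cutE' : cut_size (induced_cut v) = \sum_(i : node G) \sum_(j : node G)
    weight i j * ((1 - v j) / 2 * ((1 + v i) / 2)).
  rewrite cutE exchange_big; apply: eq_bigr => i _; apply: eq_bigr => j _.
  by rewrite weight_sym.
have -> : 4 * cut_size (induced_cut v)
    = 2 * cut_size (induced_cut v) + 2 * cut_size (induced_cut v) by ring.
rewrite {1}cutE cutE' /energy !mulr_sumr -big_split -sumrB/=.
apply: eq_bigr => i _; rewrite !mulr_sumr -big_split -sumrB/=.
by apply: eq_bigr => j _; case: (vb i) (vb j) => -> [] ->; field.
Qed.

Lemma argmin_energy_Vb v : Vb v ->
  (forall w, Vb w -> energy v <= energy w) -> argmin (@f_zero R G) v.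
Proof.
move=> vb vmin w; have [wb|wNb] := pselect (Vb w).
  by rewrite !f_zero_Vb// lee_fin vmin.
by rewrite [leRHS]/f_zero memNset// leey.
Qed.

Lemma maximum_cut_energy v : Vb v ->
  (forall w, Vb w -> energy v <= energy w) -> maximum_cut (induced_cut v).
Proof.
move=> vb vmin; split; first by exists v.
move=> _ [w wb <-]; have := vmin w wb.
rewrite !energy_cut//; lra.
Qed.

(** * Bounds on the minimizers *)

Lemma argmin_energy_le (eps : R) u v : 0 < eps -> argmin (f_eps eps) u ->
  Vb v -> energy u <= energy v.
Proof.
move=> eps0 umin vb; rewrite -(f_eps_Vb eps v vb).
apply: le_trans (umin v); rewrite lerDl mulr_ge0 ?invr_ge0 ?(ltW eps0)//.
by apply: sumr_ge0 => i _; apply: W_ge0.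
Qed.

Lemma argmin_well_le (eps : R) u v (i : node G) : 0 < eps ->
  argmin (f_eps eps) u -> Vb v -> W (u i) <= eps * energy v.
Proof.
move=> eps0 umin vb; rewrite -ler_pdivrMl// -(f_eps_Vb eps v vb).
apply: le_trans (umin v).
rewrite -[leLHS]add0r lerD ?energy_ge0// ler_pM2l ?invr_gt0//.
rewrite (bigD1 i)//= lerDl; apply: sumr_ge0 => j _; exact: W_ge0.
Qed.

End Energy.

Arguments energy {R G} u.

(** * Convergence to the sign pattern *)

(** [W x] is [(x - s) ^+ 2 * (x + s) ^+ 2] for both signs [s], and the second
    factor is at least 1 when [s] is the sign of [x]. *)
Lemma dist_sign_W (R : realType) (x : R) :
  (x - (if 0 <= x then 1 else -1)) ^+ 2 <= W x.
Proof.
have -> : W x = (x - (if 0 <= x then 1 else -1)) ^+ 2 *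
                (x + (if 0 <= x then 1 else -1)) ^+ 2.
  by rewrite /W; case: ifP => _; ring.
rewrite ler_peMr ?sqr_ge0//.
by case: ifPn => [x0|]; [|rewrite -ltNge => x0]; nra.
Qed.

Lemma normV_le (R : realType) (G : wgraph R) (r c : R) (w : nodefun G) :
  (forall i, w i ^+ 2 <= c) ->
  normV r w <= Num.sqrt (c * \sum_(i : node G) degree i `^ r).
Proof.
move=> wc; rewrite ler_wsqrtr// mulr_sumr; apply: ler_sum => i _.
by rewrite ler_wpM2r// powR_ge0.
Qed.

Lemma energy_cvg (R : realType) (G : wgraph R) (u : nat -> nodefun G)
    (u0 : nodefun G) :
  (forall i, (fun k => u k i) @ \oo --> u0 i) ->
  (fun k => energy (u k)) @ \oo --> energy u0.
Proof.
move=> ucvg; apply: cvgMl_tmp.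
apply: cvg_big => [|i _]; first exact: add_continuous.
apply: cvg_big => [|j _]; first exact: add_continuous.
by apply: cvgMl_tmp; apply: cvgM; apply: cvgD.
Qed.

Theorem theorem4p5 (R : realType) (G : wgraph R) (r : R)
    (r_ge0 : 0 <= r) (r_le1 : r <= 1)
    (eps : nat -> R) (eps_gt0 : forall k, 0 < eps k)
    (eps_dec : nonincreasing_seq eps) (eps_cvg0 : eps @ \oo --> (0 : R))
    (u : nat -> nodefun G)
    (u_min : forall k, argmin (f_eps (eps k)) (u k)) :
  exists (u0 : nodefun G) (phi : nat -> nat),
    [/\ Vb u0,
        increasing_seq phi,
        (fun k => normV r (u (phi k) \- u0)) @ \oo --> (0 : R),
        argmin (@f_zero R G) u0
      & maximum_cut (induced_cut u0)].
Proof.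
have [t [phi [phi_incr phiP]]] := finite_range_subseq {ffun node G -> bool}
  (fun k => [ffun i => 0 <= u k i]).
pose u0 : nodefun G := fun i => if t i then 1 else -1.
have u0b : Vb u0 by move=> i; rewrite /u0; case: (t i); [right|left].
have u0E k i : u0 i = if 0 <= u (phi k) i then 1 else -1.
  by rewrite /u0 -(phiP k) ffunE.
have phi_ge k : (k <= phi k)%N.
  elim: k => // k IH; apply: leq_ltn_trans IH _.
  by move/increasing_seqP: phi_incr; apply.
have eps_phi : (fun k => eps (phi k)) @ \oo --> (0 : R).
  apply: (cvg_comp phi eps) eps_cvg0.
  apply/cvgnyPge => A; exists A => // k /= Ak; exact: leq_trans (phi_ge k).
(* The minimizers are compared with their limit pattern [u0] itself. *)
have dist_le k i : (u (phi k) i - u0 i) ^+ 2 <= eps (phi k) * energy u0.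
  rewrite (u0E k); apply: le_trans (dist_sign_W _ _) _.
  exact: argmin_well_le.
have sqrt_cvg (c : R) : (fun k => Num.sqrt (eps (phi k) * c)) @ \oo --> (0 : R).
  rewrite -[X in _ --> X](sqrtr0 R); apply: continuous_cvg.
    exact: sqrt_continuous.
  by rewrite -[X in _ --> X](mul0r c); apply: cvgMr_tmp.
have u_cvg i : (fun k => u (phi k) i) @ \oo --> u0 i.
  apply/subr_cvg0; apply/norm_cvg0P.
  apply: (@squeeze_cvgr _ _ _ _ (fun=> 0) _ _ _ _ _ (sqrt_cvg (energy u0))).
    apply: nearW => k; rewrite normr_ge0/= -sqrtr_sqr ler_wsqrtr//.
  exact: cvg_cst.
have u0min (w : nodefun G) : Vb w -> energy u0 <= energy w.
  move=> wb; apply: (cvgr_to_le (energy_cvg R G (u \o phi) u0 u_cvg)).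
  by apply: nearW => k; exact: (argmin_energy_le R G (eps (phi k))).
exists u0, phi; split => //.
- apply: (@squeeze_cvgr _ _ _ _ (fun=> 0) _ _ _ _ _ (sqrt_cvg
    (energy u0 * \sum_(i : node G) degree i `^ r))).
    apply: nearW => k; rewrite sqrtr_ge0 mulrA; apply: normV_le => i.
    exact: dist_le.
  exact: cvg_cst.
- exact: argmin_energy_Vb.
- exact: maximum_cut_energy.
Qed.
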